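(* Let $(X,\varphi)$ be any permutation rack. Then the homology $\mathrm{HR}_n(X,\varphi)$ is a free abelian group for every $n$. In particular, it is torsion free. If the number $r$ of orbits of $\varphi$ is finite, then the Poincaré series is given as $$\sum_{n=0}^\infty\operatorname{rank}\mathrm{HR}_n(X,\varphi)\,T^n=\frac{1+T}{1-(r-1)T-r_{\mathrm{fin}}T^2},$$ where $r_{\mathrm{fin}}$ is the number of finite orbits.
   Context: A rack $(X,\rhd)$ is a set $X$ with a binary operation $\rhd$ such that every left multiplication $y\mapsto x\rhd y$ is a bijection and $x\rhd(y\rhd z)=(x\rhd y)\rhd(x\rhd z)$ for all $x,y,z\in X$. A permutation rack $(X,\varphi)$ is a set $X$ with a permutation $\varphi\colon X\to X$ and the rack operation $x\rhd y=\varphi(y)$. Rack homology: let $\mathrm{CR}_n(X,\varphi)=(\mathbb{Z}X)^{\otimes n}=\mathbb{Z}(X^n)$ for $n\geqslant 0$ (so $\mathrm{CR}_0=\mathbb{Z}$), with basis elements written as noncommutative monomials $x_1\cdots x_n$, and differential $\mathrm{d}\colon\mathrm{CR}_n\to\mathrm{CR}_{n-1}$, $$\mathrm{d}(x_1\cdots x_n)=\sum_{k=1}^{n-1}(-1)^{k-1}\bigl(x_1\cdots x_{k-1}x_{k+1}\cdots x_n-x_1\cdots x_{k-1}\,\varphi(x_{k+1})\cdots\varphi(x_n)\bigr).$$ The rack homology $\mathrm{HR}_n(X,\varphi)$ is the $n$-th homology of this chain complex. The identity of Poincaré series is an identity of formal power series in $T$. *)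

(* Defs.v *)
From HB Require Import structures.
From mathcomp Require Import all_boot all_order all_algebra.
From mathcomp Require Import boolp classical_sets functions cardinality.
From mathcomp Require Import ring_quotient.
From mathcomp Require Import zify.
From mathcomp.multinomials Require Import freeg.

Set Implicit Arguments.
Unset Strict Implicit.
Unset Printing Implicit Defensive.

Import GRing.Theory.

Local Open Scope ring_scope.

Section FreeAbelian.
Variable A : zmodType.

(* Every element of A is a unique finite Z-linear combination of the b i. *)
Definition Zbasis (I : choiceType) (b : I -> A) : Prop :=
  bijective (fun c : {freeg I / int} => \sum_(i <- dom c) b i *~ coeff i c).

Definition free_abelian : Prop :=
  exists (I : choiceType) (b : I -> A), Zbasis b.

Definition has_rank (k : nat) : Prop := exists b : 'I_k -> A, Zbasis b.

Definition torsion_free : Prop :=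
  forall (m : nat) (a : A), (0 < m)%N -> a *+ m = 0 -> a = 0.
End FreeAbelian.

Section Homology.
Variables (U V W : zmodType) (f : {additive U -> V}) (g : {additive V -> W}).

Definition cycle_pred : {pred V} := fun v => g v == 0.

Fact cycle_zmod_closed : zmod_closed cycle_pred.
Proof.
split=> [|u v]; rewrite !unfold_in /= ?raddf0 //.
by move=> /eqP gu /eqP gv; rewrite raddfB gu gv subrr.
Qed.
HB.instance Definition _ :=
  GRing.isZmodClosed.Build V cycle_pred cycle_zmod_closed.

Definition cycles := {v : V | v \in cycle_pred}.
HB.instance Definition _ := SubType.on cycles.
HB.instance Definition _ := Choice.on cycles.
HB.instance Definition _ := [SubChoice_isSubZmodule of cycles by <:].

Definition boundary_pred : {pred cycles} :=
  fun z => `[< exists u : U, f u = val z >].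

Fact boundary_zmod_closed : zmod_closed boundary_pred.
Proof.
split=> [|y z]; rewrite !unfold_in /=.
  by apply/asboolP; exists 0; rewrite !raddf0.
move=> /asboolP[u fu] /asboolP[v fv]; apply/asboolP.
by exists (u - v); rewrite !raddfB fu fv.
Qed.
HB.instance Definition _ :=
  GRing.isZmodClosed.Build cycles boundary_pred boundary_zmod_closed.

(* The definition needs no proof that g \o f = 0: it is the quotient of ker g
   by its intersection with im f. *)
Definition homology : zmodType := Quotient.quot boundary_pred.
End Homology.

Lemma alt_sum0 (V : lmodType int) m (G : nat -> nat -> V) :
  (forall k l, (l <= k < m)%N -> G k.+1 l = G l k) ->
  \sum_(k < m.+1) \sum_(l < m) (-1) ^+ (k + l) *: G k l = 0.
Proof.
move=> GE.
under eq_bigr => k _ do rewrite (bigID (fun l : 'I_m => (l < k)%N)) /=.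
rewrite big_split /= big_ord_recl [X in X + _ + _]big_pred0 // add0r.
rewrite [X in _ + X]big_ord_recr /= [X in _ + (_ + X)]big_pred0 ?addr0;
  last by move=> l; rewrite ltn_ord.
apply/eqP; rewrite addr_eq0 -sumrN; apply/eqP.
under eq_bigr => k _ do rewrite big_mkcond.
under [RHS]eq_bigr => k _ do rewrite big_mkcond -sumrN.
rewrite exchange_big /=; apply: eq_bigr => l _; apply: eq_bigr => k _.
rewrite /bump /= -leqNgt add1n ltnS.
case: ifP; rewrite ?oppr0 // => lk.
by rewrite GE ?lk //= addSn addnC exprS mulN1r scaleNr.
Qed.

Section RackComplex.
Variables (X : Type) (phi : X -> X).

(* {classic X} is X with the eqType and choiceType structures given by
   classical choice, so that X is an arbitrary set. *)
Definition chains (n : nat) := {freeg (n.-tuple {classic X}) / int}.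

(* Indices start from 0: for x = x_0 ... x_(n-1) and e = true (resp. false),
   face e k x deletes x_k and applies phi (resp. nothing) to the letters on
   its right. *)
Definition face (e : bool) n (k : 'I_n) (x : n.-tuple {classic X}) :
    n.-1.-tuple {classic X} :=
  [tuple if e && (k <= j)%N then phi (tnth x (fintype.lift k j))
         else tnth x (fintype.lift k j) | j < n.-1].

Definition rack_d_word n (x : n.-tuple {classic X}) : chains n.-1 :=
  \sum_(k < n | (k.+1 < n)%N)
    (-1) ^+ k *: (<< face false k x >> - << face true k x >>).

(* rack_d 0 is a map chains 0 -> chains 0; it is zero, as the sum is empty. *)
Definition rack_d n : chains n -> chains n.-1 := fglift (@rack_d_word n).

HB.instance Definition _ n :=
  GRing.isZmodMorphism.Build (chains n) (chains n.-1) (@rack_d n)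
    (lift_is_additive (@rack_d_word n)).

Lemma rack_dU n (x : n.-tuple {classic X}) : rack_d << x >> = rack_d_word x.
Proof. by rewrite /rack_d liftU scale1r. Qed.

Lemma rack_d_wordE n (x : n.+2.-tuple {classic X}) :
  rack_d_word x = \sum_(k < n.+1) (-1) ^+ k *:
     (<< face false (widen_ord (leqnSn _) k) x >>
      - << face true (widen_ord (leqnSn _) k) x >>).
Proof.
rewrite /rack_d_word big_mkcond big_ord_recr /= ltnn addr0.
by apply: eq_bigr => k _; rewrite ltnS ltn_ord.
Qed.

Lemma face_face e e' n (x : n.+2.-tuple {classic X})
    (k k0 : 'I_n.+2) (l l0 : 'I_n.+1) :
  k = l0.+1 :> nat -> k0 = l :> nat -> (l <= l0)%N ->
  face e' l (face e k x) = face e l0 (face e' k0 x).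
Proof.
move=> kE k0E ll0; apply: eq_from_tnth => j; rewrite !tnth_mktuple /= /bump.
have -> : fintype.lift k (fintype.lift l j) =
          fintype.lift k0 (fintype.lift l0 j).
  by apply: val_inj; rewrite /= /bump; lia.
set t := tnth _ _.
have -> : (k <= (l <= j) + j)%N = (l0 <= j)%N by lia.
have -> : (k0 <= (l0 <= j) + j)%N = (l <= j)%N by lia.
by case: e e' (l <= j)%N (l0 <= j)%N => [] [] [] [].
Qed.

Lemma freegUZ n (a : int) (x : n.-tuple {classic X}) :
  << a *g x >> = a *: << x >> :> chains n.
Proof. by apply/eqP/freeg_eqP => y; rewrite coeffZ !coeffU mul1r. Qed.

Lemma rack_dZ n (a : int) (c : chains n) : rack_d (a *: c) = a *: rack_d c.
Proof. by rewrite -(intz a) !scaler_int raddfMz. Qed.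

Lemma rack_dd n (c : chains n) : rack_d (rack_d c) = 0.
Proof.
rewrite -[c]freeg_sumE !raddf_sum big1 // => x _.
rewrite freegUZ /= !rack_dZ rack_dU.
suff -> : rack_d (rack_d_word x) = 0 by rewrite scaler0.
case: n x {c} => [|[|m]] x; first by rewrite /rack_d_word big_ord0 raddf0.
  by rewrite /rack_d_word big_pred0 ?raddf0 // => k;
    rewrite ltnS ltn0; case: k => [[]].
rewrite rack_d_wordE raddf_sum /=.
case: m x => [|m] x.
  rewrite big1 // => k _; rewrite rack_dZ raddfB /= !rack_dU /rack_d_word.
  by rewrite !big_pred0 ?subr0 ?scaler0 //; case=> [[]].
pose f e (k : nat) : m.+2.-tuple {classic X} := face e (inord k : 'I_m.+3) x.
pose g e' (l : nat) (y : m.+2.-tuple {classic X}) : chains m.+1 :=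
  << face e' (inord l : 'I_m.+2) y >>.
pose G k l := g false l (f false k) - g true l (f false k)
              - (g false l (f true k) - g true l (f true k)).
rewrite -[RHS](alt_sum0 (m := m.+1) (G := G)); last first.
  move=> k l /andP[lk km]; rewrite /G /g /f.
  have H e e' : face e' (inord l : 'I_m.+2) (face e (inord k.+1 : 'I_m.+3) x)
      = face e (inord k : 'I_m.+2) (face e' (inord l : 'I_m.+3) x).
    by apply: face_face; rewrite !inordK //; lia.
  rewrite !H !opprB.
  by rewrite addrACA [RHS]addrACA; congr (_ + _); rewrite addrC.
apply: eq_bigr => k _.
rewrite rack_dZ raddfB /= !rack_dU !rack_d_wordE -sumrB scaler_sumr.
apply: eq_bigr => l _; rewrite -scalerBr scalerA exprD.
have hk := ltn_ord k; have hl := ltn_ord l.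
congr (_ *: _); rewrite /G /g /f.
have -> : widen_ord (leqnSn m.+2) k = inord k.
  by apply: val_inj; rewrite /= inordK //; lia.
by have -> : widen_ord (leqnSn m.+1) l = inord l
  by apply: val_inj; rewrite /= inordK //; lia.
Qed.

Definition HR (n : nat) : zmodType :=
  homology (@rack_d n.+1) (@rack_d n).

Definition phi_orbit (x : X) : set X :=
  [set y | exists n, y = iter n phi x \/ x = iter n phi y].

Definition orbits : set (set X) := range phi_orbit.

Definition finite_orbits : set (set X) :=
  [set O | orbits O /\ finite_set O].
End RackComplex.

Definition fps_mul (p q : nat -> int) : nat -> int :=
  fun n => \sum_(i < n.+1) p i * q (n - i)%N.

(* p = num / den in Z[[T]], where the coefficient sequence p stands for the
   power series; den is a unit of Z[[T]] since its constant term is 1. *)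
Definition fps_eq_frac (p : nat -> int) (num den : {poly int}) : Prop :=
  den`_0 = 1 /\ fps_mul p (nth 0 den) =1 nth 0 num.

(* Main.v *)
Require Import Defs.
From HB Require Import structures.
From mathcomp Require Import all_boot all_order all_algebra.
From mathcomp Require Import boolp classical_sets functions cardinality.
From mathcomp Require Import generic_quotient ring_quotient zify ring.
From mathcomp.multinomials Require Import freeg.

(* Write x w for the word w with the letter x put in front of it. Then
   d (x w) = w - phi w - x (d w) for w nonempty, so prefixing by x contracts
   1 - phi on cycles, and prefixing by phi(y) y shows that y v and phi(y) v are
   homologous for every cycle v.  Fix a letter x0.  The chains
   \sum_x x w_x with \sum_x w_x = 0 form a subcomplex, in which d acts as -d on
   each w_x, while the quotient is ZX tensored with the complex shifted by 2
   (up to degrees 0 and 1). The connecting map is 1 - phi on ZX, whose kernel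
   is spanned by the finite orbits. Hence, for n >= 0, a basis of HR_{n+2} is
   given by the cycles
     (a - x0) v,                     a a representative of an orbit other than
                                     that of x0, v in a basis of HR_{n+1},
     \sum_(y in O) phi(y) y v,       O a finite orbit, v in a basis of HR_n.
   All chains of length <= 1 are cycles, with HR_0 = Z and HR_1 = Z[orbits].
   The resulting recursion on ranks is the stated identity of power series. *)

Set Implicit Arguments.
Unset Strict Implicit.
Unset Printing Implicit Defensive.

Import GRing.Theory.

Local Open Scope ring_scope.

(** * Linear maps out of a free abelian group *)

HB.instance Definition _ (K : choiceType) (M : lmodType int) (f : K -> M) :=
  GRing.isZmodMorphism.Build {freeg K / int} M (fglift f) (lift_is_additive f).

Section FreeGroup.
Variable K : choiceType.
Implicit Types (M N : lmodType int) (c : {freeg K / int}).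

Lemma freegU_scale (a : int) (k : K) :
  << a *g k >> = a *: << k >> :> {freeg K / int}.
Proof. by apply/eqP/freeg_eqP => y; rewrite coeffZ !coeffU mul1r. Qed.

Lemma additive_scale M N (f : {additive M -> N}) (a : int) (u : M) :
  f (a *: u) = a *: f u.
Proof. by rewrite -(intz a) !scaler_int raddfMz. Qed.

Lemma freeg_ind (P : {freeg K / int} -> Prop) :
  (forall c1 c2, P c1 -> P c2 -> P (c1 - c2)) -> (forall k, P << k >>) ->
  P 0 -> forall c, P c.
Proof.
move=> PB PU P0 c; rewrite -[c]freeg_sumE.
have PN c1 : P c1 -> P (- c1) by move=> Pc; rewrite -sub0r; apply: PB.
have PD c1 c2 : P c1 -> P c2 -> P (c1 + c2).
  by move=> Pc Pc2; rewrite -[c2]opprK; apply/PB/PN.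
have PM n c1 : P c1 -> P (c1 *+ n).
  by move=> Pc; elim: n => [|n IHn]; rewrite ?mulr0n // mulrS; apply: PD.
apply: (big_ind P) => // k _; rewrite freegU_scale -(intz (coeff k c)) scaler_int.
by case: (coeff k c) => n; rewrite ?NegzE ?mulrNz; [|apply: PN]; apply: PM.
Qed.

Lemma freeg_ext (V : zmodType) (f g : {additive {freeg K / int} -> V}) :
  (forall k, f << k >> = g << k >>) -> f =1 g.
Proof.
move=> fg; apply: freeg_ind => // [c1 c2 h1 h2|]; last by rewrite !raddf0.
by rewrite !raddfB /= h1 h2.
Qed.

Lemma fgliftE M (f : K -> M) c :
  fglift f c = \sum_(k <- dom c) coeff k c *: f k.
Proof.
rewrite -{1}[c]freeg_sumE raddf_sum; apply: eq_bigr => k _ /=.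
by rewrite liftU.
Qed.

Lemma fgliftU M (f : K -> M) k : fglift f << k >> = f k.
Proof. by rewrite liftU scale1r. Qed.

Lemma eq_fglift M (f g : K -> M) c :
  (forall k, coeff k c != 0 -> f k = g k) -> fglift f c = fglift g c.
Proof.
move=> fg; rewrite !fgliftE [LHS]big_seq [RHS]big_seq; apply: eq_bigr => k.
by rewrite mem_dom => /fg ->.
Qed.

Lemma additive_fglift M N (g : {additive M -> N}) (f : K -> M) c :
  g (fglift f c) = fglift (fun k => g (f k)) c.
Proof.
rewrite !fgliftE raddf_sum; apply: eq_bigr => k _; exact: additive_scale.
Qed.

Lemma fglift_id c : fglift (fun k => << k >>) c = c.
Proof.
rewrite fgliftE -[RHS]freeg_sumE; apply: eq_bigr => k _.
by rewrite [RHS]freegU_scale.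
Qed.

End FreeGroup.

Lemma fglift_comp (K L : choiceType) (M : lmodType int) (f : L -> M) (g : K -> L)
    (c : {freeg K / int}) :
  fglift f (fglift (fun k => << g k >>) c) = fglift (f \o g) c.
Proof.
rewrite (additive_fglift (fglift f)); apply: eq_fglift => k _.
by rewrite /= fgliftU.
Qed.

(** * Prefixing letters, and the recursive form of the differential *)

Section Chains.
Variables (X : Type) (phi : X -> X).
Local Notation Y := {classic X}.
Local Notation C := (chains X).

Definition consc n (x : X) : C n -> C n.+1 :=
  fglift (fun w : n.-tuple Y => << [tuple of (x : Y) :: w] >> : C n.+1).
HB.instance Definition _ n x := GRing.isZmodMorphism.Build (C n) (C n.+1)
  (@consc n x) (lift_is_additive _).

Definition phic n : C n -> C n :=
  fglift (fun w : n.-tuple Y => << (map_tuple phi w : n.-tuple Y) >> : C n).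
HB.instance Definition _ n := GRing.isZmodMorphism.Build (C n) (C n)
  (@phic n) (lift_is_additive _).

(* The components of c = \sum_x x c_x: proj (pred1 x) c = c_x, and more generally
   proj P c is the sum of the c_x with P x. *)
Definition proj n (P : pred X) : C n.+1 -> C n :=
  fglift (fun w : n.+1.-tuple Y =>
    if P (thead w) then << behead_tuple w >> else 0 : C n).
HB.instance Definition _ n P := GRing.isZmodMorphism.Build (C n.+1) (C n)
  (@proj n P) (lift_is_additive _).

(** This is [rack_d] in positive degree, with target typed [C n] rather than [C n.+1.-1], so that it
    composes with [consc], [phic] and [proj]. *)
Definition bdry n : C n.+1 -> C n := @rack_d X phi n.+1.
HB.instance Definition _ n := GRing.isZmodMorphism.Build (C n.+1) (C n)
  (@bdry n) (lift_is_additive _).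

Lemma consc_word x n (w : n.-tuple Y) :
  consc x << w >> = << [tuple of (x : Y) :: w] >> :> C n.+1.
Proof. exact: fgliftU. Qed.

Lemma phic_word n (w : n.-tuple Y) :
  phic << w >> = << (map_tuple phi w : n.-tuple Y) >> :> C n.
Proof. exact: fgliftU. Qed.

Lemma chain_ext n (V : zmodType) (f g : {additive C n.+1 -> V}) :
  (forall x w, f (consc x w) = g (consc x w)) -> f =1 g.
Proof.
by move=> fg; apply: freeg_ext => w; rewrite (tuple_eta w) -consc_word fg.
Qed.

Lemma chain0_scale (c : C 0) : c = coeff [tuple] c *: << [tuple] >>.
Proof.
by apply/eqP/freeg_eqP => w; rewrite coeffZ coeffU !tuple0 eqxx !mulr1.
Qed.

Lemma proj_cons P x n (c : C n) : proj P (consc x c) = if P x then c else 0.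
Proof.
elim/freeg_ind: c => [c1 c2 h1 h2|w|]; last by rewrite !raddf0 if_same.
  by rewrite !raddfB /= h1 h2; case: ifP; rewrite ?subr0.
rewrite consc_word /proj fgliftU theadE; case: ifP => // _.
by congr << _ >>; apply: val_inj.
Qed.

Lemma phic_cons x n (c : C n) : phic (consc x c) = consc (phi x) (phic c).
Proof.
elim/freeg_ind: c => [c1 c2 h1 h2|w|]; rewrite ?raddf0 //.
  by rewrite !raddfB /= h1 h2.
rewrite consc_word !phic_word consc_word.
by congr << _ >>; apply: val_inj.
Qed.

Lemma phic0 (c : C 0) : phic c = c.
Proof.
rewrite [c]chain0_scale additive_scale /=; congr (_ *: _).
by rewrite phic_word; congr << _ >>; apply: val_inj.
Qed.

Lemma bd_cons0 x (c : C 0) : bdry (consc x c) = 0.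
Proof.
rewrite [c]chain0_scale !additive_scale /= consc_word /bdry rack_dU /rack_d_word.
by rewrite big_pred0 ?scaler0 // => k; case: k => [[]].
Qed.

Lemma tnth_face e n (k : 'I_n) (w : n.-tuple Y) j :
  tnth (face phi e k w) j = if e && (k <= j)%N then phi (tnth w (fintype.lift k j))
                            else tnth w (fintype.lift k j).
Proof. exact: tnth_mktuple. Qed.

Lemma face_cons0 e n (k : 'I_n.+2) x (w : n.+1.-tuple Y) : k = 0%N :> nat ->
  face phi e k [tuple of (x : Y) :: w] =
  (if e then map_tuple phi w : n.+1.-tuple Y else w).
Proof.
move=> k0; apply: eq_from_tnth => j; rewrite tnth_face k0 andbT.
have -> : fintype.lift k j = fintype.lift ord0 j.
  by apply: val_inj; rewrite /= k0.
by case: e; rewrite tnthS // tnth_map.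
Qed.

Lemma face_consS e n (k : 'I_n.+3) (l : 'I_n.+2) x (w : n.+2.-tuple Y) :
  k = l.+1 :> nat ->
  face phi e k [tuple of (x : Y) :: w] = [tuple of (x : Y) :: face phi e l w].
Proof.
move=> kl; apply: eq_from_tnth => j; rewrite tnth_face kl.
case: (unliftP ord0 j) => [i|] ->.
  rewrite tnthS; apply: etrans (esym (tnth_face e l w i)).
  have -> : fintype.lift k (fintype.lift ord0 i) = fintype.lift ord0 (fintype.lift l i).
    by apply: val_inj; rewrite /= kl /bump; lia.
  by rewrite tnthS (_ : (l < fintype.lift ord0 i)%N = (l <= i)%N) //= /bump leq0n add1n ltnS.
have -> : fintype.lift k ord0 = ord0 by apply: val_inj; rewrite /= kl.
by rewrite andbF !tnth0.
Qed.

(** Deleting the prefixed letter gives [c - phic c]. Deleting a later letter keeps x in front and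
    shifts the position by one, whence the minus sign. *)
Lemma bd_cons x n (c : C n.+1) :
  bdry (consc x c) = c - phic c - consc x (bdry c).
Proof.
move: c; apply: (freeg_ext (f := @bdry n.+1 \o @consc n.+1 x)
  (g := (idfun \- @phic n.+1) \- (@consc n x \o @bdry n))) => w /=.
rewrite consc_word /bdry !rack_dU rack_d_wordE big_ord_recl /= scale1r.
rewrite !face_cons0 // phic_word; congr (_ + _).
case: n w => [|n] w.
  by rewrite big_ord0 /rack_d_word big_pred0 ?raddf0 ?oppr0 // => -[[]].
rewrite rack_d_wordE raddf_sum -sumrN; apply: eq_bigr => k _ /=.
rewrite additive_scale /= [in RHS]raddfB /= !consc_word exprS mulN1r scaleNr.
by congr (- (_ *: (<< _ >> - << _ >>))); apply: face_consS.
Qed.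

Lemma proj_phic P Q n (c : C n.+1) :
  (forall x, P (phi x) = Q x) -> proj P (phic c) = phic (proj Q c).
Proof.
move=> PQ; move: c; apply: (chain_ext (f := proj P \o @phic n.+1)
  (g := @phic n \o proj Q)) => x w /=.
by rewrite phic_cons !proj_cons PQ; case: ifP => // _; rewrite raddf0.
Qed.

Lemma bdbd n (c : C n.+2) : bdry (bdry c) = 0.
Proof. exact: (@rack_dd X phi n.+2 c). Qed.

(** This is [bd_cons] sorted by first letters. Once x is deleted from x w, the first letter is that
    of w, which explains the inner [proj predT]; in [phic] that letter has moved by phi, so P is
    tested there as Q. *)
Lemma proj_bd (P Q : pred X) n (c : C n.+2) : (forall x, P (phi x) = Q x) ->
  proj P (bdry c) = proj P (proj predT c) - phic (proj Q (proj predT c))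
                  - bdry (proj P c).
Proof.
move=> PQ; move: c.
apply: (chain_ext (f := proj P \o @bdry n.+1) (g := (proj P \o proj predT)
  \- (@phic n \o (proj Q \o proj predT)) \- (@bdry n \o proj P))) => x w /=.
rewrite bd_cons !raddfB /= !proj_cons /= (proj_phic _ PQ).
by congr (_ - _); case: ifP => // _; rewrite raddf0.
Qed.

(** Apply [proj_bd] twice: the terms in 1 - phi coming from the two deleted letters cancel. So
    selecting by the second letter and deleting the first two letters is a chain map; it is how the
    quotient complex is seen below. *)
Lemma proj_proj_bd P n (c : C n.+3) :
  proj P (proj predT (bdry c)) = bdry (proj P (proj predT c)).
Proof.
rewrite (proj_bd (Q := predT)) // !raddfB /= (proj_bd _ (Q := P \o phi)) //.
by rewrite (proj_phic (Q := P \o phi)) // subKr.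
Qed.

End Chains.

(** * Orbits *)

Section Orbits.
Variables (X : Type) (phi : X -> X).
Hypothesis phi_inj : injective phi.
Local Notation Y := {classic X}.
Local Notation orb := (phi_orbit phi).

Lemma phi_orbit_refl x : orb x x.
Proof. by exists 0%N; left. Qed.

Lemma phi_orbit_phi x : orb (phi x) = orb x.
Proof.
apply/seteqP; split=> y /= [n [yE|xE]].
- by exists n.+1; left; rewrite iterSr.
- case: n xE => [|n] xE; first by exists 1%N; left.
  by exists n; right; apply: phi_inj.
- case: n yE => [|n] yE; first by exists 1%N; right; rewrite yE.
  by exists n; left; rewrite -iterSr.
- by exists n.+1; right; rewrite xE.
Qed.

Lemma phi_orbit_iter n x : orb (iter n phi x) = orb x.
Proof. by elim: n => //= n IHn; rewrite phi_orbit_phi. Qed.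

Lemma phi_orbitE x y : orb x y <-> orb y = orb x.
Proof.
split=> [[n [->|->]]|<-]; rewrite ?phi_orbit_iter //; exact: phi_orbit_refl.
Qed.

Lemma phi_orbit_invariant (R : X -> Prop) x y :
  (forall z, R z <-> R (phi z)) -> orb x = orb y -> R x -> R y.
Proof.
move=> Rphi /esym/phi_orbitE xy.
have Ri n z : R z <-> R (iter n phi z) by elim: n => //= n ->.
by case: xy => n [->|->]; rewrite -Ri.
Qed.

Lemma finite_orbit_enum x : finite_set (orb x) ->
  exists s : seq Y, uniq s /\ forall y, y \in s <-> orb y = orb x.
Proof.
move=> /(@finite_seqP Y)[s sE]; exists (undup s); split; first exact: undup_uniq.
by move=> y; rewrite mem_undup -phi_orbitE sE.
Qed.

(** An injective map of a finite orbit into itself is a permutation of it, so sums over the orbit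
    can be reindexed by phi. *)
Lemma orbit_enum_perm x (s : seq Y) : uniq s ->
  (forall y, y \in s <-> orb y = orb x) -> perm_eq [seq phi y : Y | y <- s] s.
Proof.
move=> s_uniq sE; have ms_uniq : uniq [seq phi y : Y | y <- s].
  by rewrite (@map_inj_uniq Y Y phi phi_inj).
have sub : {subset [seq phi y : Y | y <- s] <= s}.
  by move=> _ /(@mapP Y Y)[y /sE ys ->]; apply/sE; rewrite phi_orbit_phi.
apply: uniq_perm => //.
by have [] := uniq_min_size ms_uniq sub; rewrite ?size_map.
Qed.

Lemma infinite_orbit_avoid x (s : seq Y) : infinite_set (orb x) ->
  exists y : Y, orb y = orb x /\ y \notin s.
Proof.
move=> inf; apply: contrapT => H; apply: inf.
apply: (@sub_finite_set Y _ [set` s]); last exact: finite_seq.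
move=> y /phi_orbitE yx; apply: contrapT => /negP ys; apply: H; exists y.
by split.
Qed.

End Orbits.

(** * Decomposition of a chain by its first letters *)

Section Support.
Variable X : Type.
Local Notation Y := {classic X}.
Local Notation C := (chains X).

Lemma proj1_cons (x y : X) n (c : C n) :
  proj (pred1 (x : Y)) (consc y c) = if (y : Y) == x then c else 0.
Proof. exact: proj_cons. Qed.

Lemma chain_support n (c : C n.+1) : exists s : seq Y,
  c = \sum_(x <- s) consc x (proj (pred1 x) c) /\
  forall x, x \notin s -> proj (pred1 x) c = 0.
Proof.
exists (undup [seq thead w | w <- dom c]); set s := undup _.
have sc w : w \in dom c -> thead w \in s.
  by move=> wc; rewrite mem_undup; apply: map_f.
have projU x w : w \in dom c -> proj (pred1 x) << w >> =
    if thead w == x then << behead_tuple w >> else 0 :> C n.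
  by move=> _; rewrite /proj fgliftU.
split.
  (* The list s depends on c, so the decomposition is checked only on the words occurring in c,
     whose first letters lie in s. *)
  transitivity (fglift (fun w => \sum_(x <- s) consc x (proj (pred1 x) << w >>)) c).
    rewrite -{1}(fglift_id c); apply: eq_fglift => w; rewrite -mem_dom => wc.
    rewrite (bigD1_seq (thead w)) ?undup_uniq ?sc //= projU // eqxx.
    rewrite consc_word -tuple_eta big1 ?addr0 // => x xw.
    by rewrite projU // eq_sym (negPf xw) raddf0.
  rewrite fgliftE; under eq_bigr do rewrite scaler_sumr.
  rewrite exchange_big /=; apply: eq_bigr => x _.
  by rewrite -[in RHS](fglift_id c) (additive_fglift (proj (pred1 x)))
    (additive_fglift (consc x)) fgliftE.
move=> x xs; rewrite -(fglift_id c) (additive_fglift (proj (pred1 x))) fgliftE.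
rewrite big_seq big1 // => w wc.
rewrite /= projU //; case: eqP => [E|_]; last exact: scaler0.
by rewrite -E sc in xs.
Qed.

End Support.

(** * Boundaries and homologous cycles *)

Section Boundaries.
Variables (X : Type) (phi : X -> X).
Hypothesis phi_inj : injective phi.
Local Notation Y := {classic X}.
Local Notation C := (chains X).
Local Notation orb := (phi_orbit phi).
Local Notation phic := (@phic X phi _).
Local Notation bd := (@bdry X phi _).

Definition boundary n (c : C n) : Prop := exists u : C n.+1, bd u = c.

Lemma boundary_bd n (u : C n.+1) : boundary (bd u).
Proof. by exists u. Qed.

Lemma boundary0 n : boundary (0 : C n).
Proof. by exists 0; rewrite raddf0. Qed.

Lemma boundaryD n (c1 c2 : C n) : boundary c1 -> boundary c2 -> boundary (c1 + c2).
Proof. by move=> [u1 <-] [u2 <-]; exists (u1 + u2); rewrite raddfD. Qed.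

Lemma boundaryN n (c : C n) : boundary c -> boundary (- c).
Proof. by move=> [u <-]; exists (- u); rewrite raddfN. Qed.

Lemma boundaryB n (c1 c2 : C n) : boundary c1 -> boundary c2 -> boundary (c1 - c2).
Proof. by move=> ? ?; apply/boundaryD/boundaryN. Qed.

Lemma boundary_phic (x : X) n (c : C n) : rack_d phi c = 0 -> boundary (c - phic c).
Proof.
case: n c => [|n] c dc; first by rewrite phic0 subrr; exact: boundary0.
by exists (consc x c); rewrite bd_cons [bdry _ _]dc raddf0 subr0.
Qed.

(** Expand by [bd_cons] twice. The prefix phi(y) is chosen so that phi(y c) = phi(y) phi(c) cancels
    against the term phi(y) phi(c) coming from the inner differential. *)
Lemma bd_phi_cons y n (c : C n.+1) :
  bd (consc (phi y) (consc y c)) =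
  consc y c - consc (phi y) c + consc (phi y) (consc y (bd c)).
Proof.
rewrite !bd_cons phic_cons !raddfB /= !opprK.
by rewrite addrA addrACA addNr addr0.
Qed.

Lemma bd_phi_cons0 y (c : C 0) :
  bd (consc (phi y) (consc y c)) = consc y c - consc (phi y) c.
Proof. by rewrite !bd_cons bd_cons0 phic_cons phic0 raddf0 subr0. Qed.

Lemma boundary_cons_orbit x y n (c : C n) : rack_d phi c = 0 ->
  orb x = orb y -> boundary (consc x c - consc y c).
Proof.
move=> dc xy; have E z : boundary (consc z c - consc (phi z) c).
  exists (consc (phi z) (consc z c)).
  case: n c dc => [|n] c dc; first by rewrite bd_phi_cons0.
  by rewrite bd_phi_cons [bdry _ _]dc !raddf0 addr0.
apply: (phi_orbit_invariant phi_inj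
  (R := fun z => boundary (consc x c - consc z c)) _ xy) => [z|].
  split=> H; first by move: (boundaryD H (E z)); rewrite addrA subrK.
  by move: (boundaryB H (E z)); rewrite opprB addrA subrK.
by rewrite subrr; exact: boundary0.
Qed.

End Boundaries.

(** * A recursive basis of the homology *)

Section HomologyBasis.
Variables (X : Type) (phi : X -> X).
Hypothesis phi_inj : injective phi.
Local Notation Y := {classic X}.
Local Notation C := (chains X).
Local Notation orb := (phi_orbit phi).
Local Notation phic := (@phic X phi _).
Local Notation bd := (@bdry X phi _).
Local Notation boundary := (boundary phi).

(** Cycles whose classes form a basis of HR_n, expressed on chains modulo boundaries so that the
    computation never enters the quotient group. *)
Record homology_basis n (I : choiceType) (b : I -> C n) : Prop := {
  hb_cycle : forall i, rack_d phi (b i) = 0;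
  hb_span : forall z, rack_d phi z = 0 -> exists c, boundary (z - fglift b c);
  hb_free : forall c, boundary (fglift b c) -> c = 0 }.

Lemma rack_d0 (c : C 0) : rack_d phi c = 0.
Proof.
by rewrite [c]chain0_scale rack_dZ rack_dU /rack_d_word big_ord0 scaler0.
Qed.

Lemma bd0 (u : C 1) : bd u = 0.
Proof.
move: u; apply: (chain_ext (f := @bdry X phi 0) (g := \0)) => x w /=.
exact: bd_cons0.
Qed.

Lemma homology_basis_bij n (I J : choiceType) (b : I -> C n) (g : J -> I) :
  bijective g -> homology_basis b -> homology_basis (b \o g).
Proof.
move=> [h gK hK] [bc bs bf].
split=> [j|z /bs[c zc]|c]; first exact: bc.
  exists (fglift (fun i => << h i >>) c).
  rewrite fglift_comp (eq_fglift (g := b)) // => i _.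
  by rewrite /= hK.
rewrite -fglift_comp => /bf c0; rewrite -(fglift_id c).
transitivity (fglift (fun i => << h i >> : {freeg J / int})
   (fglift (fun j => << g j >> : {freeg I / int}) c)); last by rewrite c0 raddf0.
by rewrite fglift_comp; apply: eq_fglift => j _; rewrite /= gK.
Qed.

Lemma proj1_bd_eq0 (P Q : pred X) n (z : C n.+2) : (forall x, P (phi x) = Q x) ->
  bd z = 0 ->
  proj P (proj predT z) - phic (proj Q (proj predT z)) = bd (proj P z).
Proof.
move=> PQ dz; apply/eqP; rewrite -subr_eq0; apply/eqP.
by rewrite -(proj_bd _ PQ) dz raddf0.
Qed.

(** The letters [alpha] represent all orbits, with [alpha None] as the base letter x0; the letters
    [beta] represent the finite orbits, and [enum f] lists the orbit of [beta f]. *)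
Variables (A F : choiceType) (alpha : option A -> X) (beta : F -> X).
Variable enum : F -> seq Y.
Hypothesis alpha_inj : injective (fun a => orb (alpha a)).
Hypothesis alpha_surj : forall x, exists a, orb (alpha a) = orb x.
Hypothesis beta_inj : injective (fun f => orb (beta f)).
Hypothesis beta_fin : forall f, finite_set (orb (beta f)).
Hypothesis beta_surj : forall x, finite_set (orb x) -> exists f, orb (beta f) = orb x.
Hypothesis enum_uniq : forall f, uniq (enum f).
Hypothesis enumE : forall f y, y \in enum f <-> orb y = orb (beta f).

Definition orbit_chain (f : F) n (v : C n) : C n.+2 :=
  \sum_(y <- enum f) consc (phi y) (consc y v).

Fact orbit_chain_zmod f n : zmod_morphism (@orbit_chain f n).
Proof.
by move=> u v; rewrite -sumrB; apply: eq_bigr => y _; rewrite !raddfB.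
Qed.
HB.instance Definition _ f n := GRing.isZmodMorphism.Build (C n) (C n.+2)
  (@orbit_chain f n) (@orbit_chain_zmod f n).

Lemma sum_consc_phi f n (v : C n) :
  \sum_(y <- enum f) consc (phi y) v = \sum_(y <- enum f) consc y v.
Proof.
rewrite -[RHS](perm_big _ (orbit_enum_perm phi_inj (enum_uniq f) (enumE f))).
by rewrite big_map.
Qed.

Lemma bd_orbit_chain0 f (v : C 0) : bd (orbit_chain f v) = 0.
Proof.
rewrite raddf_sum /=; under eq_bigr do rewrite bd_phi_cons0.
by rewrite sumrB sum_consc_phi subrr.
Qed.

(** In the sum of [bd_phi_cons] over the orbit, the terms y v and phi(y) v cancel since phi permutes
    the orbit. This is where finiteness enters. *)
Lemma bd_orbit_chain f n (v : C n.+1) : bd (orbit_chain f v) = orbit_chain f (bd v).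
Proof.
rewrite raddf_sum /=; under eq_bigr do rewrite bd_phi_cons.
by rewrite big_split /= sumrB sum_consc_phi subrr add0r.
Qed.

Lemma orbit_chain_cycle f n (v : C n) : rack_d phi v = 0 -> bd (orbit_chain f v) = 0.
Proof.
case: n v => [|n] v dv; first exact: bd_orbit_chain0.
by rewrite bd_orbit_chain [bdry _ _]dv raddf0.
Qed.

(** Every letter of the orbit is the second letter of exactly one summand, with v behind it. Second
    letters thus detect which orbit chains occur in a chain. *)
Lemma proj_orbit_chain f x n (v : C n) :
  proj (pred1 (x : Y)) (proj predT (orbit_chain f v)) =
  if `[< orb x = orb (beta f) >] then v else 0.
Proof.
rewrite !raddf_sum; under eq_bigr do rewrite /= proj_cons /= proj1_cons.
case: asboolP => [/enumE xf|xf].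
  rewrite (bigD1_seq (x : Y)) //= eqxx big1 ?addr0 // => y.
  by move=> /negPf->.
rewrite big_seq big1 // => y /enumE yf.
by case: eqP => // yx; case: xf; rewrite -yx.
Qed.

(** * From bases in degrees m and m + 1 to a basis in degree m + 2 *)

Section Step.
Variables (m : nat) (I J : choiceType) (b1 : I -> C m.+1) (b2 : J -> C m).
Hypothesis hb1 : homology_basis b1.
Hypothesis hb2 : homology_basis b2.

Definition step_basis (k : A * I + F * J) : C m.+2 :=
  match k with
  | inl (a, i) => consc (alpha (Some a)) (b1 i) - consc (alpha None) (b1 i)
  | inr (f, j) => orbit_chain f (b2 j)
  end.

Let x0 := alpha None.

Lemma step_basis_cycle k : rack_d phi (step_basis k) = 0.
Proof.
case: k => [[a i]|[f j]] /=; last exact/orbit_chain_cycle/(hb_cycle hb2).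
rewrite -[rack_d _ _]/(bd _) raddfB /= !bd_cons.
by rewrite [bdry _ (b1 i)](hb_cycle hb1 i) !raddf0 !addr0 subrr.
Qed.

Let spanned (z : C m.+2) := exists c, boundary (z - fglift step_basis c).

Let spannedD z1 z2 : spanned z1 -> spanned z2 -> spanned (z1 + z2).
Proof.
move=> [c1 h1] [c2 h2]; exists (c1 + c2).
by rewrite raddfD /= opprD addrACA; apply: boundaryD.
Qed.

Let spanned_boundary z : boundary z -> spanned z.
Proof. by move=> bz; exists 0; rewrite raddf0 subr0. Qed.

Let spanned_sum (T : Type) (s : seq T) (G : T -> C m.+2) :
  (forall t, spanned (G t)) -> spanned (\sum_(t <- s) G t).
Proof.
move=> h; apply: (big_ind spanned) => //; exact/spanned_boundary/boundary0.
Qed.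

Let spanned_fglift (K : choiceType) (g : K -> A * I + F * J) c :
  spanned (fglift (step_basis \o g) c).
Proof.
exists (fglift (fun k => << g k >>) c).
by rewrite fglift_comp subrr; exact: boundary0.
Qed.

Let spanned_edge_rep a (v : C m.+1) : bd v = 0 ->
  spanned (consc (alpha (Some a)) v - consc x0 v).
Proof.
move=> dv; have [c [u uE]] := hb_span hb1 dv.
pose D : {additive C m.+1 -> C m.+2} := consc (alpha (Some a)) \- consc x0.
rewrite -[X in spanned X]/(D v) -(subrK (fglift b1 c) v) -uE raddfD /=.
apply: spannedD.
  (* Prefixing by a - x0 anticommutes with d, as the terms u - phi u cancel; hence the order of the
     difference. *)
  apply: spanned_boundary; exists (consc x0 u - consc (alpha (Some a)) u).
  by rewrite raddfB /= !bd_cons opprB addrC addrA subrK.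
rewrite -[X in spanned X]/(D (fglift b1 c)) additive_fglift.
exact: (spanned_fglift (fun i => inl (a, i))).
Qed.

Let spanned_edge x (v : C m.+1) : bd v = 0 -> spanned (consc x v - consc x0 v).
Proof.
move=> dv; have [a ax] := alpha_surj x.
have bx : boundary (consc x v - consc (alpha a) v).
  exact: boundary_cons_orbit.
case: a ax bx => [a|] ax bx; last exact: spanned_boundary.
rewrite -(subrK (consc (alpha (Some a)) v) (consc x v)) -addrA.
by apply: spannedD (spanned_boundary bx) (spanned_edge_rep a dv).
Qed.

Let spanned_orbit f (v : C m) : rack_d phi v = 0 -> spanned (orbit_chain f v).
Proof.
move=> dv; have [c [u uE]] := hb_span hb2 dv.
rewrite -(subrK (fglift b2 c) v) -uE raddfD /=; apply: spannedD.
  by apply: spanned_boundary; exists (orbit_chain f u); rewrite bd_orbit_chain.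
rewrite additive_fglift.
exact: (spanned_fglift (fun j => inr (f, j))).
Qed.

(* On the quotient complex d maps x0 y v to y (d v). *)
Lemma boundary_lift (s : C m.+1) :
  (forall x : Y, boundary (proj (pred1 x) s)) ->
  exists t : C m.+2, proj predT (bd (consc x0 t)) = s.
Proof.
have [L [sE _]] := chain_support s; move=> bs; rewrite {}sE.
elim/big_rec: _ => [|x _ _ [t <-]]; first by exists 0; rewrite !raddf0.
(* If d u is the component of s at x, then d (x0 x u) with first letters deleted is u - phi u - (u -
   phi u - x (d u)) = x (d u). *)
have [u <-] := bs x; exists (consc x u + t); rewrite !raddfD /=; congr (_ + _).
rewrite bd_cons bd_cons !raddfB /= phic_cons !proj_cons /=.
by rewrite !opprK addrA addrACA subrr addNr !add0r.
Qed.

Lemma component_cycle P n (z : C n.+2) : bd z = 0 ->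
  rack_d phi (proj P (proj predT z)) = 0.
Proof.
case: n z => [|n] z dz; last first.
  by rewrite -[rack_d _ _]/(bd _) -proj_proj_bd dz !raddf0.
exact: rack_d0.
Qed.

(* The components of a cycle z satisfy s_(phi y) - phi s_y = d z_(phi y), where
   s_y is the part of z with second letter y, the first two letters being
   deleted; so the class of s_y is constant along orbits. *)
Lemma orbit_component_boundary (z : C m.+2) x y : bd z = 0 -> orb x = orb y ->
  boundary (proj (pred1 (x : Y)) (proj predT z) -
            proj (pred1 (y : Y)) (proj predT z)).
Proof.
move=> dz xy; set s := fun x => proj (pred1 (x : Y)) (proj predT z).
rewrite -/(s x) -/(s y).
have E w : boundary (s w - s (phi w)).
  rewrite -(subrK (phic (s w)) (s w)) -addrA.
  apply: boundaryD; first exact/(boundary_phic x0)/component_cycle.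
  rewrite -opprB; apply: boundaryN; rewrite (proj1_bd_eq0 _ dz).
    exact: boundary_bd.
  by move=> t /=; apply/eqP/eqP => [/phi_inj|->].
apply: (phi_orbit_invariant phi_inj (R := fun w => boundary (s x - s w)) _ xy).
  move=> w; split=> H; first by move: (boundaryD H (E w)); rewrite addrA subrK.
  by move: (boundaryB H (E w)); rewrite opprB addrA subrK.
by rewrite subrr; exact: boundary0.
Qed.

(** Only finitely many second letters occur in z, so some letter of the infinite orbit has component
    zero, and components along an orbit are homologous. *)
Lemma infinite_component_boundary (z : C m.+2) x : bd z = 0 ->
  infinite_set (orb x) -> boundary (proj (pred1 (x : Y)) (proj predT z)).
Proof.
move=> dz xinf; have [L [_ L0]] := chain_support (proj predT z).
have [y [yx yL]] := infinite_orbit_avoid phi_inj L xinf.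
have := orbit_component_boundary dz (esym yx).
by rewrite (L0 y yL) subr0.
Qed.

(** As the components z_x sum to zero, z is the sum of the (x - x0) z_x. Each z_x is a cycle,
    because [proj_bd] reduces to d z_x = 0 when [proj predT z] vanishes. *)
Let spanned_augmented (z : C m.+2) : bd z = 0 -> proj predT z = 0 -> spanned z.
Proof.
move=> dz Ez; have [L [zE _]] := chain_support z.
have -> : z = \sum_(x <- L) (consc x (proj (pred1 x) z) -
                             consc x0 (proj (pred1 x) z)).
  rewrite sumrB -zE -raddf_sum.
  suff -> : \sum_(x <- L) proj (pred1 x) z = proj predT z by rewrite Ez raddf0 subr0.
  rewrite [in RHS]zE raddf_sum; apply: eq_bigr => x _.
  by rewrite /= proj_cons.
apply: spanned_sum => x; apply: spanned_edge.
rewrite -(proj1_bd_eq0 (Q := fun y => pred1 x (phi y : Y)) _ dz) // Ez.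
by rewrite !raddf0 addr0.
Qed.

Let step_basis_span (z : C m.+2) : bd z = 0 -> spanned z.
Proof.
move=> dz; pose s (z : C m.+2) (x : Y) := proj (pred1 x) (proj predT z).
pose fin_rep (x : X) : option F :=
  if pselect (finite_set (orb x)) is left h then Some (projT1 (cid (beta_surj h)))
  else None.
have fin_repP x : if fin_rep x is Some f then orb (beta f) = orb x
                  else infinite_set (orb x).
  by rewrite /fin_rep; case: pselect => // h; case: cid.
(* L contains all second letters of z, so [Fs] is a finite list containing every finite orbit on
   which z has a nonzero second-letter component; [z1] copies the component at each
   representative. *)
have [L [_ L0]] := chain_support (proj predT z).
pose Fs := undup (pmap fin_rep L).
pose z1 := \sum_(f <- Fs) orbit_chain f (s z (beta f)).
have dz1 : bd z1 = 0.
  rewrite raddf_sum big1 // => f _; apply: orbit_chain_cycle.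
  exact: component_cycle.
(* Three cases. On an infinite orbit [z1] contributes nothing and the component of z is a boundary.
   On an orbit in [Fs] the difference compares two letters of the same orbit. On any other finite
   orbit both terms vanish. *)
have bs x : boundary (s (z - z1) x).
  have -> : s (z - z1) x =
      s z x - \sum_(f <- Fs) if `[< orb x = orb (beta f) >] then s z (beta f) else 0.
    rewrite /s !raddfB /= [in X in _ - X]raddf_sum raddf_sum; congr (_ - _).
    by apply: eq_bigr => f _; rewrite /= proj_orbit_chain.
  move: (fin_repP x); case Ex: (fin_rep x) => [f|] xf; last first.
    rewrite big1 ?subr0; first exact: infinite_component_boundary.
    move=> f _; case: asboolP => // xf'; case: xf; rewrite xf'; exact: beta_fin.
  have [fF|fF] := boolP (f \in Fs).
    rewrite (bigD1_seq f) ?undup_uniq //= asboolT // big1 ?addr0.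
      exact: orbit_component_boundary.
    move=> g gf; case: asboolP => // xg; case/eqP: gf.
    by apply: beta_inj; rewrite /= -xg.
  have sx0 : s z x = 0.
    apply: L0; apply: contra fF => xL.
    by rewrite mem_undup (@mem_pmap Y) -Ex (@map_f Y).
  rewrite sx0 big_seq big1 ?subr0; first exact: boundary0.
  move=> g gF; case: asboolP => // xg; case/negP: fF.
  by rewrite (_ : f = g) //; apply: beta_inj; rewrite /= xf.
(* Subtracting d (x0 t) makes the components of z - z1 sum to zero. *)
have [t tE] := boundary_lift bs.
rewrite -(subrK z1 z); apply: spannedD; last first.
  by apply: spanned_sum => f; apply/spanned_orbit/component_cycle.
rewrite -(subrK (bd (consc x0 t)) (z - z1)); apply: spannedD; last first.
  exact/spanned_boundary/boundary_bd.
apply: spanned_augmented; last by rewrite raddfB /= tE subrr.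
by rewrite !raddfB /= bdbd dz dz1 !subr0.
Qed.

(** Coefficients are read off by projections that turn the given boundary into boundaries in lower
    degree: second letters isolate the orbit chains, then, once these are gone, first letters summed
    over an orbit isolate the differences (a - x0) v. *)
Let step_basis_free c : boundary (fglift step_basis c) -> c = 0.
Proof.
move=> [u uE].
have c_inr f j : coeff (inr (f, j)) c = 0.
  (* [fglift r c] is the block of c at the orbit f, to which the freeness of [b2] applies. *)
  pose r (k : A * I + F * J) : {freeg J / int} :=
    if k is inr (g, j) then if g == f then << j >> else 0 else 0.
  have rE d : coeff j (fglift r d) = coeff (inr (f, j)) d.
    move: d; apply: (freeg_ext (f := coeff j \o fglift r) (g := coeff (inr (f, j)))).
    move=> k /=; rewrite fgliftU coeffU mul1r; case: k => [[a i]|[g l]] /=.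
      by rewrite raddf0.
    rewrite -[inr _ == _]/((g, l) == (f, j)) xpair_eqE.
    by case: eqP => _; rewrite ?raddf0 // coeffU mul1r.
  rewrite -rE (hb_free hb2 (c := fglift r c)) ?raddf0 //.
  exists (proj (pred1 (beta f : Y)) (proj predT u)).
  rewrite -proj_proj_bd uE (additive_fglift (proj predT)).
  rewrite (additive_fglift (proj (pred1 _))) (additive_fglift (fglift b2)).
  apply: eq_fglift => -[[a i]|[g l]] _ /=.
    by rewrite raddfB /= !proj_cons subrr !raddf0.
  rewrite proj_orbit_chain; case: eqP => [->|gf]; first by rewrite asboolT // fgliftU.
  by rewrite asboolF ?raddf0 // => fg; apply: gf; apply: beta_inj.
have inlP k : coeff k c != 0 -> if k is inl _ then true else false.
  by case: k => // -[f j]; rewrite c_inr eqxx.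
(* Only differences (a - x0) v remain, and their components cancel. By [proj_proj_bd], every
   [proj P (proj predT u)] is then a cycle. *)
have Ez : proj predT (bd u) = 0.
  rewrite uE (additive_fglift (proj predT)) fgliftE big1 // => k _.
  case: k => [[a i]|[f j]]; last by rewrite c_inr scale0r.
  by rewrite /= raddfB /= !proj_cons subrr scaler0.
have c_inl a i : coeff (inl (a, i)) c = 0.
  pose r (k : A * I + F * J) : {freeg I / int} :=
    if k is inl (g, i) then if g == a then << i >> else 0 else 0.
  have rE d : coeff i (fglift r d) = coeff (inl (a, i)) d.
    move: d; apply: (freeg_ext (f := coeff i \o fglift r) (g := coeff (inl (a, i)))).
    move=> k /=; rewrite fgliftU coeffU mul1r; case: k => [[g l]|[f j]] /=; last first.
      by rewrite raddf0.
    rewrite -[inl _ == _]/((g, l) == (a, i)) xpair_eqE.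
    by case: eqP => _; rewrite ?raddf0 // coeffU mul1r.
  rewrite -rE (hb_free hb1 (c := fglift r c)) ?raddf0 //.
  (* O is stable under phi and excludes x0. So [proj_bd] expresses [proj O (bd u)] as (1 - phi) of a
     cycle minus a boundary, and (1 - phi) of a cycle is a boundary. *)
  pose O : pred X := fun x => `[< orb x = orb (alpha (Some a)) >].
  have Ophi x : O (phi x) = O x by rewrite /O phi_orbit_phi.
  have -> : fglift b1 (fglift r c) = proj O (bd u).
    rewrite uE (additive_fglift (proj O)) (additive_fglift (fglift b1)).
    apply: eq_fglift => -[[g l]|[f j]] /inlP //= _.
    rewrite raddfB /= !proj_cons [O x0]asboolF ?subr0; last by move=> /alpha_inj.
    case: eqP => [->|ga]; first by rewrite [O _]asboolT // fgliftU.
    by rewrite [O _]asboolF ?raddf0 // => /alpha_inj [] /ga.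
  rewrite (proj_bd _ Ophi); apply: boundaryB; last exact: boundary_bd.
  apply: (boundary_phic x0); rewrite -[rack_d _ _]/(bd _).
  by rewrite -proj_proj_bd Ez raddf0.
apply/eqP/freeg_eqP => -[[a i]|[f j]]; by rewrite ?c_inl ?c_inr raddf0.
Qed.

Lemma homology_basis_step : homology_basis step_basis.
Proof.
split; [exact: step_basis_cycle|exact: step_basis_span|exact: step_basis_free].
Qed.

End Step.

Let one : C 0 := << [tuple] >>.

Lemma homology_basis1 :
  homology_basis (fun a : option A => consc (alpha a) one).
Proof.
split=> [a|z _|c [u uE]]; first exact: bd_cons0.
  have [L [-> _]] := chain_support z.
  elim/big_rec: _ => [|x y _ [c cE]]; first by exists 0; rewrite raddf0 subr0; exact: boundary0.
  have [a ax] := alpha_surj x; set w := proj _ z.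
  exists (coeff [tuple] w *: << a >> + c).
  rewrite raddfD /= opprD addrACA; apply: boundaryD => //.
  rewrite (additive_scale (fglift _)) /= fgliftU -(additive_scale (consc _)) -chain0_scale.
  exact: (boundary_cons_orbit phi_inj (rack_d0 w)).
apply/eqP/freeg_eqP => a; rewrite raddf0.
(* Counting the letters in one orbit kills boundaries: phi acts trivially on [C 0] and d vanishes on
   [C 1]. *)
pose O : pred X := fun x => `[< orb x = orb (alpha a) >].
have Ophi x : O (phi x) = O x by rewrite /O phi_orbit_phi.
transitivity (coeff [tuple] (proj O (bd u))); last first.
  by rewrite (proj_bd _ Ophi) phic0 bd0 subrr subr0 raddf0.
rewrite uE (additive_fglift (proj O)); move: c {uE}.
apply: (freeg_ext (f := coeff a) (g := coeff [tuple] \o fglift _)) => k /=.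
rewrite fgliftU proj_cons !coeffU mul1r; case: eqP => [->|ka].
  by rewrite [O _]asboolT // coeffU (eqxx ([tuple] : 0.-tuple Y)).
by rewrite [O _]asboolF ?raddf0 // => /alpha_inj.
Qed.

End HomologyBasis.

Lemma homology_basis0 X (phi : X -> X) :
  homology_basis phi (fun _ : unit => << [tuple] >> : chains X 0).
Proof.
split=> [_|z _|c [u]].
- by rewrite rack_dU /rack_d_word big_ord0.
- exists (coeff [tuple] z *: << tt >>).
  rewrite (additive_scale (fglift _)) /= fgliftU -chain0_scale subrr.
  exact: boundary0.
rewrite bd0 => /esym /(congr1 (coeff [tuple])) cE.
apply/eqP/freeg_eqP => -[]; rewrite !raddf0 in cE *; rewrite -{}cE.
move: c; apply: (freeg_ext (f := coeff tt) (g := coeff [tuple] \o fglift _)).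
by case; rewrite /= fgliftU !coeffU (eqxx ([tuple] : 0.-tuple {classic X})).
Qed.

Lemma homology_basis_empty X (phi : X -> X) n : (X -> False) ->
  homology_basis phi (fun v : void => of_void (chains X n.+1) v).
Proof.
move=> X0; have C0 (z : chains X n.+1) : z = 0.
  by apply/eqP/freeg_eqP => w; case: (X0 (thead w)).
split=> [[]|z _|c _]; last by apply/eqP/freeg_eqP => -[].
exists 0; rewrite (C0 z) raddf0 subr0; exact: boundary0.
Qed.

(** * From cycle representatives to the quotient group *)

Section HomologyClass.
Variables (U V W : zmodType) (f : {additive U -> V}) (g : {additive V -> W}).

Local Open Scope quotient_scope.

Definition hclass (z : cycles g) : homology f g :=
  \pi_(Quotient.quot (boundary_pred f (g := g))) z.

Fact hclass_zmod : zmod_morphism hclass.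
Proof. exact: raddfB. Qed.
HB.instance Definition _ := GRing.isZmodMorphism.Build (cycles g) (homology f g)
  hclass hclass_zmod.

Lemma hclass_surj h : exists z, hclass z = h.
Proof. by exists (repr h); rewrite /hclass reprK. Qed.

Lemma hclass_eq0 z : hclass z = 0 <-> exists u, f u = val z.
Proof.
have -> : hclass z = 0 <-> z \in boundary_pred f (g := g).
  rewrite -{2}[z]subr0 Quotient.idealrBE -[_ == _]/(hclass z == hclass 0) raddf0.
  by split=> [->|/eqP].
by rewrite unfold_in; split=> /asboolP.
Qed.

End HomologyClass.

Lemma Zbasis_torsion_free (A : zmodType) (I : choiceType) (b : I -> A) :
  Zbasis b -> torsion_free A.
Proof.
move=> b_bij m a m_gt0 am0.
(* [zmodule A] is A with its canonical structure of module over the integers, which [fglift]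
   requires. *)
pose comb : {additive {freeg I / int} -> zmodule A} := fglift (b : I -> zmodule A).
have combE c : \sum_(i <- dom c) b i *~ coeff i c = comb c by rewrite [RHS]fgliftE.
have [k combK kK] := b_bij.
have cm0 : k a *+ m = 0.
  apply: (bij_inj b_bij); rewrite /= !combE raddfMn raddf0 /= -combE kK.
  exact: am0.
rewrite -(kK a) combE; suff -> : k a = 0 by rewrite raddf0.
apply/eqP/freeg_eqP => i; rewrite raddf0; apply/eqP.
have /eqP := congr1 (coeff i) cm0.
by rewrite raddfMn raddf0 Num.Theory.mulrn_eq0 eqn0Ngt m_gt0.
Qed.

Section ZbasisHomology.
Variables (U W : zmodType) (V : lmodType int).
Variables (f : {additive U -> V}) (g : {additive V -> W}).
Variables (I : choiceType) (b : I -> V).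
Hypothesis b_cycle : forall i, g (b i) = 0.
Hypothesis b_span : forall z, g z = 0 -> exists c u, f u = z - fglift b c.
Hypothesis b_free : forall c u, f u = fglift b c -> c = 0.

Let b_in i : b i \in cycle_pred g.
Proof. by rewrite unfold_in b_cycle. Qed.

Let bz i : cycles g := Sub (b i) (b_in i).

Let comb (c : {freeg I / int}) : cycles g := \sum_(i <- dom c) bz i *~ coeff i c.

Let val_comb c : val (comb c) = fglift b c.
Proof.
rewrite fgliftE raddf_sum; apply: eq_bigr => i _.
by rewrite raddfMz /= -scaler_int intz.
Qed.

Lemma Zbasis_homology : Zbasis (fun i => hclass f (bz i)).
Proof.
have combE c : \sum_(i <- dom c) hclass f (bz i) *~ coeff i c = hclass f (comb c).
  by rewrite raddf_sum; apply: eq_bigr => i _; rewrite raddfMz.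
have comb_surj h : exists c, hclass f (comb c) = h.
  have [y <-] := hclass_surj h.
  have [c [u uE]] := b_span (eqP (valP y)).
  exists c; apply/esym/eqP; rewrite -subr_eq0 -raddfB; apply/eqP/hclass_eq0.
  by exists u; rewrite uE raddfB /= val_comb.
pose k h := projT1 (cid (comb_surj h)).
have kK h : hclass f (comb (k h)) = h by rewrite /k; case: cid.
exists k => [c|h]; rewrite combE //.
apply/eqP; rewrite -subr_eq0; apply/eqP; set c1 := k _.
have /hclass_eq0 [u uE] : hclass f (comb c1 - comb c) = 0.
  by rewrite raddfB /= kK subrr.
by apply: (b_free (u := u)); rewrite uE !raddfB /= !val_comb.
Qed.

End ZbasisHomology.

Lemma Zbasis_HR X (phi : X -> X) n (I : choiceType) (b : I -> chains X n) :
  homology_basis phi b -> exists b' : I -> HR phi n, Zbasis b'.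
Proof.
move=> [bc bs bf].
eexists; apply: (@Zbasis_homology _ _ _ _ _ I b bc) => [z /bs[c [u uE]]|c u uE].
  by exists c, u.
by apply: bf; exists u.
Qed.

(** * Orbit representatives and ranks *)

Section Transversal.
Variables (X : Type) (phi : X -> X).
Local Notation orb := (phi_orbit phi).

Definition transversal (S : set (set X)) (T : Type) (t : T -> X) : Prop :=
  [/\ injective (fun i => orb (t i)), forall i, S (orb (t i)) &
      forall O, S O -> exists i, orb (t i) = O].

Lemma transversal_of_bij (S : set (set X)) (T : Type) (g : T -> set X) :
  (S `<=` orbits phi)%classic -> set_bij [set: T]%classic S g ->
  exists t : T -> X, transversal S t.
Proof.
move=> Sorb [gS g_inj g_surj].
have gO i : exists x, orb x = g i by have [x _ <-] := Sorb _ (gS i I); exists x.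
have [t tE] := choice gO; exists t; split=> [i j|i|O SO].
- by rewrite !tE; apply: g_inj; rewrite in_setT.
- by rewrite tE; exact: gS.
- by have [i _ <-] := g_surj _ SO; exists i.
Qed.

Lemma transversal_exists (S : set (set X)) : (S `<=` orbits phi)%classic ->
  exists (T : choiceType) (t : T -> X), transversal S t.
Proof.
move=> Sorb; exists {classic {O : set X | S O}}.
apply: (transversal_of_bij (g := fun O => proj1_sig O)) => //; split=> [O _|O1 O2 _ _|O SO].
- exact: proj2_sig.
- by case: O1 O2 => [O1 h1] [O2 h2] /= O12; apply: eq_exist.
- by exists (exist _ O SO).
Qed.

Lemma transversal_finite (S : set (set X)) k : (S `<=` orbits phi)%classic ->
  (S #= `I_k)%card -> exists t : 'I_k -> X, transversal S t.
Proof.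
move=> Sorb /card_esym Sk.
have /card_set_bijP[g gbij] : ([set: 'I_k]%classic #= S)%card.
  exact: card_eq_trans (card_esym card_II) Sk.
exact: transversal_of_bij gbij.
Qed.

End Transversal.

Section Bases.
Variables (X : Type) (phi : X -> X).
Hypothesis phi_inj : injective phi.
Local Notation orb := (phi_orbit phi).

Variables (A F : choiceType) (alpha : A -> X) (beta : F -> X) (x0 : X).
Hypothesis alphaT : transversal phi (orbits phi `\ orb x0)%classic alpha.
Hypothesis betaT : transversal phi (finite_orbits phi) beta.

Let rep (a : option A) := if a is Some a then alpha a else x0.

Let rep_inj : injective (fun a => orb (rep a)).
Proof.
have [ainj aS _] := alphaT; move=> [a|] [a'|] //= => [/ainj ->//|E|E].
  by case: (aS a) => _ /=; rewrite E.
by case: (aS a') => _ /=; rewrite -E.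
Qed.

Let rep_surj x : exists a, orb (rep a) = orb x.
Proof.
have [_ _ asurj] := alphaT; have [->|xx0] := pselect (orb x = orb x0).
  by exists None.
have [|a aE] := asurj (orb x); first by split => //; exists x.
by exists (Some a).
Qed.

Lemma homology_basis_orbits : exists b : option A -> chains X 1, homology_basis phi b.
Proof. eexists; exact: (homology_basis1 phi_inj rep_inj rep_surj). Qed.

Lemma homology_basis_recursion n (I J : choiceType)
    (b1 : I -> chains X n.+1) (b2 : J -> chains X n) :
  homology_basis phi b1 -> homology_basis phi b2 ->
  exists b : (A * I + F * J)%type -> chains X n.+2, homology_basis phi b.
Proof.
move=> hb1 hb2; have [binj bS bsurj] := betaT.
have [enum enumP] := choice (fun f => finite_orbit_enum phi_inj (bS f).2).
eexists; apply: (homology_basis_step phi_inj rep_inj rep_surj binj _ _ _ _ hb1 hb2).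
- by move=> f; exact: (bS f).2.
- move=> x xfin; apply: bsurj; split=> //; by exists x.
- by move=> f; exact: (enumP f).1.
- by move=> f; exact: (enumP f).2.
Qed.

Lemma homology_basis_exists n :
  exists (I : choiceType) (b : I -> chains X n), homology_basis phi b.
Proof.
(* The recursion reaches back two degrees, so the induction carries two consecutive ones. *)
suff [] : (exists (I : choiceType) (b : I -> chains X n), homology_basis phi b) /\
  (exists (I : choiceType) (b : I -> chains X n.+1), homology_basis phi b) by [].
elim: n => [|n [[J [b2 hb2]] [I [b1 hb1]]]].
  have [b hb] := homology_basis_orbits.
  by split; [exists unit; eexists; exact: homology_basis0|exists (option A), b].
have [b hb] := homology_basis_recursion hb1 hb2.
by split; [exists I, b1|eexists; exists b].
Qed.

End Bases.

(* Here r is one less than the number of orbits. *)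
Fixpoint rack_rank (r rfin n : nat) : nat :=
  match n with
  | 0 => 1
  | n1.+1 => if n1 is n2.+1 then r * rack_rank r rfin n1 + rfin * rack_rank r rfin n2
             else r.+1
  end.

Lemma homology_basis_fin X (phi : X -> X) n (T : finType) k (b : T -> chains X n) :
  #|T| = k -> homology_basis phi b ->
  exists b' : 'I_k -> chains X n, homology_basis phi b'.
Proof.
move=> <- hb; exists (b \o enum_val).
by apply: homology_basis_bij hb; exact: enum_val_bij.
Qed.

Lemma homology_basis_rank X (phi : X -> X) r rfin
    (alpha : 'I_r -> X) (beta : 'I_rfin -> X) x0 n : injective phi ->
  transversal phi (orbits phi `\ phi_orbit phi x0)%classic alpha ->
  transversal phi (finite_orbits phi) beta ->
  exists b : 'I_(rack_rank r rfin n) -> chains X n, homology_basis phi b.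
Proof.
move=> phi_inj alphaT betaT.
suff [] : (exists b : 'I_(rack_rank r rfin n) -> chains X n, homology_basis phi b) /\
  (exists b : 'I_(rack_rank r rfin n.+1) -> chains X n.+1, homology_basis phi b) by [].
elim: n => [|n [[b2 hb2] [b1 hb1]]]; split.
- by apply: (homology_basis_fin _ (homology_basis0 phi)); rewrite card_unit.
- have [b hb] := homology_basis_orbits phi_inj alphaT.
  by apply: (homology_basis_fin _ hb); rewrite card_option card_ord.
- by exists b1.
- have [b hb] := homology_basis_recursion phi_inj alphaT betaT hb1 hb2.
  by apply: (homology_basis_fin _ hb); rewrite card_sum !card_prod !card_ord.
Qed.

(** * The power series identity *)

Lemma fps_eq_frac_recursion (p : nat -> int) (a b : int) :
  p 0%N = 1 -> p 1%N = 1 + a -> (forall n, p n.+2 = a * p n.+1 + b * p n) ->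
  fps_eq_frac p (1 + 'X) (1 - a *: 'X - b *: 'X^2).
Proof.
move=> p0 p1 pS; set den := (1 - _ - _).
have denE k : den`_k = (k == 0%N)%:R - a * (k == 1%N)%:R - b * (k == 2%N)%:R.
  by rewrite /den !coefB !coefZ coef1 coefX coefXn.
split; first by rewrite denE /= !mulr0 !subr0.
move=> n; rewrite /fps_mul coefD coef1 coefX.
case: n => [|[|n]].
- by rewrite big_ord1 denE p0 /=; ring.
- rewrite !big_ord_recr big_ord0 /= !denE p0 p1 /=.
  by ring.
(* The denominator has degree at most 2, so only the last three terms of the convolution survive,
   and they cancel by the recursion. *)
rewrite !big_ord_recr /= big1 => [|i _].
  rewrite !denE pS subnn subSnn (_ : n.+2 - n = 2)%N; last by lia.
  by rewrite /=; ring.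
have hi := ltn_ord i; rewrite denE.
have -> : (n.+2 - i = (n - i.+1).+3)%N by lia.
by rewrite /=; ring.
Qed.

Lemma card_II_empty T (S : set T) k : (forall x, ~ S x) -> (S #= `I_k)%card -> k = 0%N.
Proof.
move=> S0 /card_esym; have -> : S = set0 by apply/seteqP; split=> x //= /S0.
by rewrite card_eq0 => /eqP/seteqP[/(_ 0%N) k0 _]; case: k k0 => // k /(_ (ltn0Sn k)).
Qed.

Theorem theoremE (X : Type) (phi : X -> X) (phi_bij : bijective phi) :
  (forall n : nat, free_abelian (HR phi n)) /\
  (forall n : nat, torsion_free (HR phi n)) /\
  (forall r rfin : nat,
     (orbits phi #= `I_r)%card ->
     (finite_orbits phi #= `I_rfin)%card ->
     exists rank : nat -> nat,
       (forall n : nat, has_rank (HR phi n) (rank n)) /\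
       fps_eq_frac (fun n => (rank n)%:Z)
         (1 + 'X)
         (1 - (r%:Z - 1) *: 'X - rfin%:Z *: 'X^2)).
Proof.
have phi_inj := bij_inj phi_bij.
have fin_sub : (finite_orbits phi `<=` orbits phi)%classic by move=> O [].
have bases n : exists (I : choiceType) (b : I -> chains X n), homology_basis phi b.
  have [[x0]|X0] := pselect (inhabited X).
    have [F [beta betaT]] := transversal_exists fin_sub.
    have [A [alpha alphaT]] := @transversal_exists X phi
      (orbits phi `\ phi_orbit phi x0)%classic (@subDsetl _ _ _).
    exact: (homology_basis_exists phi_inj alphaT betaT).
  case: n => [|n]; first by exists unit; eexists; exact: homology_basis0.
  exists void; eexists; apply: homology_basis_empty => x; apply: X0; by exists.
have free n : free_abelian (HR phi n).
  have [I [b hb]] := bases n; exists I; exact: Zbasis_HR hb.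
split=> //; split=> [n|r rfin orb_r fin_rfin].
  by have [I [b hb]] := free n; exact: Zbasis_torsion_free hb.
(* Without letters there is no x0. The complex is then Z in degree 0, and r = rfin = 0 turns the
   fraction into (1 + T) / (1 + T) = 1. *)
have [[x]|X0] := pselect (inhabited X); last first.
  have no_orbit (O : set X) : ~ orbits phi O by case=> x; case: X0; exists.
  have r0 : r = 0%N by apply: card_II_empty orb_r.
  have rfin0 : rfin = 0%N by apply: card_II_empty fin_rfin => O [/no_orbit].
  exists (fun n => (n == 0%N : nat)); split=> [[|n]|].
  - have [b hb] := homology_basis_fin card_unit (homology_basis0 phi).
    exact: Zbasis_HR hb.
  - have hb : homology_basis phi (fun v : void => of_void (chains X n.+1) v).
      apply: homology_basis_empty => x; apply: X0; by exists.
    have [b' hb'] := homology_basis_fin card_void hb.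
    exact: Zbasis_HR hb'.
  rewrite r0 rfin0; exact: fps_eq_frac_recursion.
case: r orb_r => [|r] orb_r.
  move: orb_r; rewrite II0 card_eq0 => /eqP/seteqP[/(_ (phi_orbit phi x)) orb0 _].
  by case: orb0; exists x.
(* Removing the orbit of x0 leaves r orbits, now that r has been replaced by its predecessor; they
   index the letters a of the basis. *)
have [O [x0 _ <-] orb_r'] := eq_cardSP _ _ orb_r.
have [beta betaT] := transversal_finite fin_sub fin_rfin.
have [alpha alphaT] := transversal_finite (@subDsetl _ _ _) orb_r'.
exists (rack_rank r rfin); split=> [n|].
  have [b hb] := homology_basis_rank n phi_inj alphaT betaT.
  exact: Zbasis_HR hb.
have -> : r.+1%:Z - 1 = r by lia.
by apply: fps_eq_frac_recursion => // n; rewrite -!PoszM -PoszD.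
Qed.
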